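(* For every integer $r\ge 2$ there is $n_0(r)$ such that the following holds. Let $n\ge n_0(r)$ and $0 \leq d \leq \frac{n}{28r^2}$, and let $G$ be a graph with $n$ vertices and minimum degree at least $\frac{(r+1)n}{2r} + d$. Then in every $r$-colouring of the edges of $G$ there is a Hamilton cycle with at least $\frac{n}{r} + 2d$ edges of the same colour.
   Context: Graphs are finite and simple. An $r$-colouring of the edges is an arbitrary map $E(G)\to[r]$. *)

(* Defs.v *)
From mathcomp Require Import all_boot all_order all_algebra.

Set Implicit Arguments.
Unset Strict Implicit.
Unset Printing Implicit Defensive.

Record sgraph (V : finType) := SGraph {
  adj :> rel V;
  adj_sym : symmetric adj;
  adj_irr : irreflexive adj
}.

Definition edge_set (V : finType) (G : sgraph V) : {set {set V}} :=
  [set [set x; y] | x in [set: V], y in [set y | G x y]].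

Definition edge (V : finType) (G : sgraph V) : finType :=
  {A : {set V} | A \in edge_set G}.

Definition edge_colouring (V : finType) (G : sgraph V) (r : nat) : Type :=
  edge G -> 'I_r.

Definition degree (V : finType) (G : sgraph V) (v : V) : nat :=
  #|[set u | G v u]|.

(* Every degree is smaller than #|V|, so the default value #|V| of the
   iterated minimum never wins when V is nonempty. *)
Definition min_degree (V : finType) (G : sgraph V) : nat :=
  \big[minn/#|V|]_(v : V) degree G v.

(* A Hamilton cycle is given by a cyclic enumeration of the vertices.  The
   bound on the size excludes [:: x; y], which path.v accepts as a cycle as
   soon as x and y are adjacent. *)
Definition hamilton_cycle (V : finType) (G : sgraph V) (s : seq V) : Prop :=
  [/\ 2 < size s, cycle G s, uniq s & forall v : V, v \in s].

Definition cycle_edges (V : finType) (s : seq V) : {set {set V}} :=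
  [set [set x; next s x] | x in s].

Definition coloured_cycle_edges (V : finType) (G : sgraph V) (r : nat)
    (c : edge_colouring G r) (s : seq V) (i : 'I_r) : {set edge G} :=
  [set a : edge G | (val a \in cycle_edges s) && (c a == i)].

(* Main.v *)
(* Put k = ceil(n/r + 2d); the degree hypothesis says 2 delta(G) >= n + k.  By
   Posa's exchange argument a cyclic ordering of the vertices with at least k
   edges of colour i (equivalently, a linear forest with k edges of that colour)
   can be turned into a Hamilton cycle with at least k edges of colour i.

   So suppose that for every colour i the best cyclic ordering s has only
   f_i < k edges of colour i.  Call u a break of s if u and its successor are not
   joined in colour i; there are n - f_i breaks.  Maximality against 2-opt moves
   gives deg_i u + deg_i v <= f_i for any two breaks u, v, so at most k vertices
   have 2 deg_i > f_i.  Since 2 delta >= n + k, every vertex is of this kind in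
   some colour, and all but (r - 1) k vertices, hence at least k - mu of them with
   mu = r k - n, are of this kind in colour i only; such a vertex z has
   2 deg_i z >= 2 k - mu.  If two breaks u, w had deg_i > mu, make w the successor
   of u: whenever v is a neighbour of u, the successor v' of v satisfies
   deg_i v' + deg_i w <= f_i, so v' avoids those k - mu vertices, which leaves too
   few places for the neighbours of u.  Hence all but k vertices have
   deg_i <= mu.  As mu is at most about n / (14 r), G then has too few edges. *)
Require Import Defs.
From mathcomp Require Import all_boot all_order all_algebra.
From mathcomp Require Import zify ring lra.

Set Implicit Arguments.
Unset Strict Implicit.
Unset Printing Implicit Defensive.

(** * Cyclic orderings and the 2-opt move *)

Definition ordering (V : finType) (s : seq V) : Prop :=
  uniq s /\ forall v : V, v \in s.

Definition cyc_count (V : finType) (h : rel V) (s : seq V) : nat :=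
  \sum_(x : V) h x (next s x).

Definition deg (V : finType) (h : rel V) (x : V) : nat := \sum_(y : V) h x y.

(** The count along an open path: additive under concatenation, so the reversal of a segment can be
    tracked. *)
Definition adj_count (V : finType) (h : rel V) (x : V) (p : seq V) : nat :=
  sumn (pairmap (fun y z => h y z : nat) x p).

Lemma adj_count_cat (V : finType) (h : rel V) (x : V) (p q : seq V) :
  adj_count h x (p ++ q) = adj_count h x p + adj_count h (last x p) q.
Proof. by rewrite /adj_count pairmap_cat sumn_cat. Qed.

Lemma adj_count_rev (V : finType) (h : rel V) (x y : V) (p : seq V) :
  symmetric h ->
  adj_count h x (rcons p y) = adj_count h y (rcons (rev p) x).
Proof.
move=> hS; elim: p x => [|z p IHp] x; first by rewrite /adj_count /= hS.
rewrite rev_cons -[RHS]/(adj_count h y (rcons (rcons (rev p) z) x)).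
rewrite -[rcons (rcons _ _) x]cats1 adj_count_cat last_rcons -IHp addnC.
by rewrite /adj_count /= addn0 hS.
Qed.

Lemma next_head (V : finType) (x : V) (p q : seq V) :
  uniq (p ++ x :: q) -> next (p ++ x :: q) x = head x (q ++ p).
Proof.
move=> Us; rewrite -(next_rot (size p) Us) rot_size_cat /=.
by case: (q ++ p) => [|y t] /=; rewrite eqxx.
Qed.

Lemma ordering_rot (V : finType) (i : nat) (s : seq V) :
  ordering s -> ordering (rot i s).
Proof. by case=> Us As; split=> [|v]; rewrite ?rot_uniq ?mem_rot. Qed.

Lemma cyc_count_rot (V : finType) (h : rel V) (i : nat) (s : seq V) :
  uniq s -> cyc_count h (rot i s) = cyc_count h s.
Proof. by move=> Us; apply: eq_bigr => x _; rewrite next_rot. Qed.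

Lemma cyc_count_cons (V : finType) (h : rel V) (x : V) (p : seq V) :
  ordering (x :: p) -> cyc_count h (x :: p) = adj_count h x (rcons p x).
Proof.
case=> Us As; rewrite /cyc_count /adj_count.
have -> : \sum_(y : V) h y (next (x :: p) y)
        = \sum_(y <- x :: p) h y (next (x :: p) y).
  by rewrite [RHS]big_uniq //; apply: eq_bigl => y; rewrite As.
rewrite sumnE (big_nth x) [RHS](big_nth 0) size_pairmap size_rcons.
apply: eq_big_nat => i /andP[_ ltis].
rewrite (nth_pairmap x) ?size_rcons // next_nth mem_nth // index_uniq //.
congr (nat_of_bool (h _ _)); last first.
  rewrite nth_rcons; case: ltnP => // le; rewrite nth_default //.
  by case: eqP.
by rewrite -rcons_cons nth_rcons ltis.
Qed.

(* The edges u u' and v v' of the cycle are replaced by u v and u' v', where x'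
   is the successor of x.  The count is given for all h at once because Posa's
   argument follows two relations along the same move. *)
Lemma two_opt (V : finType) (s : seq V) (u v : V) :
  ordering s -> u != v ->
  exists s', [/\ ordering s', next s' u = v,
    next s' (next s u) = next s v &
    forall h : rel V, symmetric h ->
      cyc_count h s' + h u (next s u) + h v (next s v)
      = cyc_count h s + h u v + h (next s u) (next s v)].
Proof.
move=> Os neq; have [Us As] := Os.
have [i p Ep] := rot_to (As u).
have {Os} Or : ordering (u :: p) by rewrite -Ep; apply: ordering_rot.
have En : next s =1 next (u :: p) by move=> x; rewrite -Ep next_rot.
have Ec (h : rel V) : cyc_count h s = cyc_count h (u :: p).
  by rewrite -Ep cyc_count_rot.
suff: exists s', [/\ ordering s', next s' u = v,
    next s' (next (u :: p) u) = next (u :: p) v &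
    forall h : rel V, symmetric h ->
      cyc_count h s' + h u (next (u :: p) u) + h v (next (u :: p) v)
      = cyc_count h (u :: p) + h u v + h (next (u :: p) u) (next (u :: p) v)].
  by case=> s' [O1 N1 N2 C1]; exists s'; split; rewrite ?En // => h /C1; rewrite Ec.
have vp : v \in p by have := Or.2 v; rewrite inE eq_sym (negPf neq).
case/splitPr: vp Or => p1 p2 Or {Ep En Ec i Us As s}.
have Nv : next (u :: p1 ++ v :: p2) v = head u p2.
  by rewrite -cat_cons next_head ?cat_cons; [case: p2 {Or} | case: Or].
(* If [v] already follows [u], the removed and the added edges coincide. *)
case: p1 Or Nv => [|a q] Or Nv.
  have Nu : next (u :: v :: p2) u = v by rewrite /= eqxx.
  by exists (u :: v :: p2); rewrite cat0s Nu.
have Nu : next (u :: (a :: q) ++ v :: p2) u = a by rewrite /= eqxx.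
(* The segment from [a] to [v] is reversed. *)
have P : perm_eq (u :: v :: rev q ++ a :: p2) (u :: (a :: q) ++ v :: p2).
  by apply/permP => x; rewrite /= !count_cat /= count_rev; lia.
have O' : ordering (u :: v :: rev q ++ a :: p2).
  by case: Or => Us As; split=> [|x]; rewrite ?(perm_uniq P) ?(perm_mem P).
exists (u :: v :: rev q ++ a :: p2); split=> //.
- by rewrite /= eqxx.
- rewrite Nu Nv -[u :: _]/((u :: v :: rev q) ++ a :: p2) next_head ?O'.1 //.
  by case: p2 {Or Nu Nv P O'}.
move=> h hS; rewrite !cyc_count_cons // Nu Nv.
have E b t c : adj_count h b (c :: t) = h b c + adj_count h c t by [].
rewrite !rcons_cons !rcons_cat !rcons_cons /= !E.
rewrite -!cat_rcons !adj_count_cat !last_rcons (adj_count_rev v a) // revK.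
have Eb b : adj_count h b (rcons p2 u)
    = h b (head u p2) + adj_count h (head u p2) (behead (rcons p2 u)).
  by case: p2 {Or Nu Nv P O'} => [|c t].
rewrite (Eb v) (Eb a); lia.
Qed.

Lemma next_sum (V : finType) (s : seq V) (F : V -> nat) :
  ordering s -> \sum_x F (next s x) = \sum_x F x.
Proof.
case=> Us _; rewrite [RHS](reindex (next s)) //=.
by exists (prev s) => x _; rewrite ?prev_next ?next_prev.
Qed.

(** * Posa's exchange argument *)

(** At a step of [s] outside [g], a suitable 2-opt move raises [cyc_count g] and keeps [cyc_count h]
    at least [k]; if there is none, the two ends of that step violate the degree condition. *)
Lemma posa_exchange (V : finType) (g h : rel V) (k : nat) (s : seq V) :
  symmetric g -> irreflexive g -> symmetric h -> subrel h g ->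
  (forall v, #|V| + k <= 2 * deg g v) ->
  ordering s -> k <= cyc_count h s ->
  exists s', [/\ ordering s', k <= cyc_count h s' & forall x, g x (next s' x)].
Proof.
move=> gS gI hS hg dg.
have [m] := ubnP (#|V| - cyc_count g s); elim: m s => // m IHm s lem Os ks.
have [/forallP all_g|] := boolP [forall x, g x (next s x)]; first by exists s.
case/forallPn=> u ngu.
have nhu : h u (next s u) = false by apply: contraNF ngu; apply: hg.
have cg : cyc_count g s < #|V|.
  rewrite -sum1_card /cyc_count (bigD1 u) //= [X in _ < X](bigD1 u) //= (negPf ngu).
  by rewrite add0n add1n ltnS leq_sum // => i _; case: (g _ _).
have [/existsP[v /and3P[uv suv /implyP hv]]|] :=
    boolP [exists v, [&& g u v, g (next s u) (next s v) &
                         h v (next s v) ==> (k < cyc_count h s)]].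
  have neq : u != v by apply: contraTneq uv => <-; rewrite gI.
  have [s' [Os' _ _ E]] := two_opt Os neq.
  have := E g gS; have := E h hS.
  rewrite (negPf ngu) nhu uv suv => Eh Eg.
  apply: (IHm s') => //.
    move: Eg lem cg; case: (g v _) => /=;
      by move: #|V| (cyc_count g s) (cyc_count g s'); clear; lia.
  move: Eh ks hv; case: (h v _) => /= Eh ks hv; [have := hv isT|];
    by move: Eh ks; move: (cyc_count h s) (cyc_count h s'); clear; lia.
move/existsPn=> none.
(* Write x' for the successor of x. If u v and u' v' are both in [g], the move at [v] is blocked
   only when v v' is in [h] and [cyc_count h s] is at most [k]; so at most [k] vertices [v]
   contribute 2 to the sum. *)
have : deg g u + deg g (next s u) <= (#|V|.-1) + k.
  rewrite /deg -(next_sum (fun x => g (next s u) x : nat) Os) -big_split /=.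
  pose b := cyc_count h s <= k.
  apply: (@leq_trans (\sum_v ((v != u) + (h v (next s v) && b)))).
    apply: leq_sum => v _; case: eqVneq => [->|neq]; first by rewrite !gI.
    have := none v; rewrite /b; case: (g u v); case: (g (next s u) _) => //=.
    by rewrite negb_imply -leqNgt => ->.
  rewrite big_split /= leq_add //.
    by rewrite -big_mkcond /= sum1_card cardC1.
  rewrite /b; case: (leqP (cyc_count h s) k) => [le|_]; last first.
    by rewrite big1 // => v _; rewrite andbF.
  by apply: leq_trans le; apply: leq_sum => v _; rewrite andbT.
have := dg u; have := dg (next s u).
have : 0 < #|V| by apply/card_gt0P; exists u.
lia.
Qed.

(** * Orderings that are maximal for one relation *)

Definition max_ordering (V : finType) (h : rel V) (s : seq V) : Prop :=
  ordering s /\ forall s', ordering s' -> cyc_count h s' <= cyc_count h s.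

Lemma ordering_max (V : finType) (h : rel V) :
  exists s, max_ordering h s.
Proof.
have Oe : ordering (enum V).
  by split=> [|v]; rewrite ?enum_uniq ?mem_enum.
have szo (s : seq V) : ordering s -> size s == #|V|.
  case=> Us As; rewrite cardE; apply/eqP/perm_size/uniq_perm => //.
    by rewrite enum_uniq.
  by move=> v; rewrite mem_enum As.
have ordP (s : seq V) : uniq s -> size s = #|V| -> ordering s.
  move=> Us sz; split=> // v.
  have [||_ ->] := @uniq_min_size _ s (enum V) Us; rewrite ?mem_enum //.
    by move=> x; rewrite mem_enum.
  by rewrite -cardE sz.
pose P (t : #|V|.-tuple V) := uniq t.
have P0 : P (Tuple (szo _ Oe)) by rewrite /P enum_uniq.
have [t Pt tmax] := arg_maxnP (fun t : #|V|.-tuple V => cyc_count h t) P0.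
exists t; split; first by apply: ordP; rewrite ?size_tuple.
by move=> s Os; apply: (tmax (Tuple (szo _ Os))); rewrite /P /=; case: Os.
Qed.

(** A move that loses nothing leads to another maximal ordering, so bounds for consecutive vertices
    extend to pairs that a move makes consecutive. *)
Lemma max_two_opt (V : finType) (h : rel V) (s : seq V) (u v : V) :
  symmetric h -> max_ordering h s -> u != v ->
  h u v + h (next s u) (next s v) <= h u (next s u) + h v (next s v) /\
  (h u (next s u) + h v (next s v) <= h u v + h (next s u) (next s v) ->
   exists s', [/\ max_ordering h s', cyc_count h s' = cyc_count h s,
     next s' u = v & next s' (next s u) = next s v]).
Proof.
move=> hS [Os ms] neq; have [s' [Os' N1 N2 /(_ h hS) E]] := two_opt Os neq.
have le := ms s' Os'; split; first by lia.
move=> ge; have Es : cyc_count h s' = cyc_count h s by lia.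
by exists s'; split=> //; split=> // t Ot; rewrite Es; apply: ms.
Qed.

(** With x' the successor of x, maximality gives h(u,v) + h(u',v') <= h(v,v') for each [v] other
    than [u]; sum over [v]. *)
Lemma deg_break (V : finType) (h : rel V) (s : seq V) (u : V) :
  symmetric h -> irreflexive h -> max_ordering h s -> ~~ h u (next s u) ->
  deg h u + deg h (next s u) <= cyc_count h s.
Proof.
move=> hS hI ms nhu.
rewrite /deg -(next_sum (fun x => h (next s u) x : nat) ms.1) -big_split /=.
apply: leq_sum => v _; case: (eqVneq u v) => [<-|neq]; first by rewrite !hI.
by have [+ _] := max_two_opt hS ms neq; rewrite (negPf nhu).
Qed.

(** Neither added edge can lie in [h], so the move is neutral and creates two new breaks: [u]
    followed by [v], and u' followed by v'. [deg_break] applies to both. *)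
Lemma break_pair (V : finType) (h : rel V) (s : seq V) (u v : V) :
  symmetric h -> irreflexive h -> max_ordering h s -> u != v ->
  ~~ h u (next s u) -> ~~ h v (next s v) ->
  [/\ ~~ h u v, deg h u + deg h v <= cyc_count h s,
     deg h (next s u) + deg h (next s v) <= cyc_count h s &
     exists s', [/\ max_ordering h s', cyc_count h s' = cyc_count h s &
       next s' u = v]].
Proof.
move=> hS hI ms neq nhu nhv; have [le] := max_two_opt hS ms neq.
move: le; rewrite (negPf nhu) (negPf nhv) leqn0 addn_eq0 !eqb0 => /andP[huv hsuv].
case=> // s' [ms' Es N1 N2]; split=> //; last by exists s'.
  by rewrite -Es -N1; apply: deg_break => //; rewrite N1.
by rewrite -Es -N2; apply: deg_break => //; rewrite N2.
Qed.

(** The move trades v v' for v x, both in [h]; maximality keeps v' x' out of [h], so v' is a break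
    of an equally good ordering. *)
Lemma break_neighbour (V : finType) (h : rel V) (s : seq V) (v x : V) :
  symmetric h -> irreflexive h -> max_ordering h s ->
  h v (next s v) -> ~~ h x (next s x) -> h v x ->
  deg h (next s v) + deg h (next s x) <= cyc_count h s.
Proof.
move=> hS hI ms hv nhx hvx.
have neq : v != x by apply: contraTneq hvx => ->; rewrite hI.
have [le] := max_two_opt hS ms neq.
move: le; rewrite hv (negPf nhx) hvx /= => le.
case=> [|s' [ms' Es _ N2]]; first by lia.
by rewrite -Es -N2; apply: deg_break => //; rewrite N2; case: (h _ _) le.
Qed.

(** * Few vertices have large or medium degree *)

Definition breaks (V : finType) (h : rel V) (s : seq V) : {set V} :=
  [set u | ~~ h u (next s u)].

Lemma card_breaks (V : finType) (h : rel V) (s : seq V) :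
  cyc_count h s + #|breaks h s| = #|V|.
Proof.
rewrite /cyc_count /breaks -sum1dep_card [X in _ + X]big_mkcond /=.
rewrite -big_split /= -sum1_card.
by apply: eq_bigr => u _; case: (h _ _).
Qed.

Lemma degE (V : finType) (h : rel V) (u : V) : deg h u = #|[set v | h u v]|.
Proof.
rewrite /deg -sum1dep_card [RHS]big_mkcond.
by apply: eq_bigr => v _; case: (h u v).
Qed.

Lemma card_few_breaks (V : finType) (h : rel V) (s : seq V) (A : {set V}) :
  #|A :&: breaks h s| <= 1 -> #|A| <= (cyc_count h s).+1.
Proof.
have := card_breaks h s; have := cardsUI A (breaks h s).
have := max_card (mem (A :|: breaks h s)).
move: #|A| #|breaks h s| #|V| #|_ :|: _| #|_ :&: _| => a b n p q; lia.
Qed.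

Lemma card_large_deg (V : finType) (h : rel V) (s : seq V) :
  symmetric h -> irreflexive h -> max_ordering h s ->
  #|[set v | cyc_count h s < 2 * deg h v]| <= (cyc_count h s).+1.
Proof.
move=> hS hI ms; apply: card_few_breaks; apply/card_le1_eqP => u v.
rewrite !inE => /andP[du nhu] /andP[dv nhv]; apply/eqP.
rewrite eq_sym; apply/negPn/negP => neq.
by have [] := break_pair hS hI ms neq nhu nhv; lia.
Qed.

(* P plays the role of the vertices of large degree in this colour only. *)
Lemma card_medium_deg (V : finType) (h : rel V) (s : seq V) (P : {set V})
    (mu : nat) :
  symmetric h -> irreflexive h -> max_ordering h s ->
  {in P, forall z, cyc_count h s < 2 * deg h z} ->
  {in P, forall z, cyc_count h s <= deg h z + mu} ->
  cyc_count h s < #|P| + mu ->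
  #|[set v | mu < deg h v]| <= (cyc_count h s).+1.
Proof.
move=> hS hI ms P2 Pmu cP; apply: card_few_breaks; apply/card_le1_eqP => u w.
rewrite !inE => /andP[du nhu] /andP[dw nhw]; apply/eqP.
rewrite eq_sym; apply/negPn/negP => neq.
have [_ _ _ [s' [ms' Es Nu]]] := break_pair hS hI ms neq nhu nhw.
rewrite -Es in P2 Pmu cP.
have [nhuw _ _ _] := break_pair hS hI ms neq nhu nhw.
have nhu' : ~~ h u (next s' u) by rewrite Nu.
have [[Us' As'] _] := ms'.
have inj : injective (next s') by apply: can_inj (prev_next Us').
(* [T] avoids [B] because no two breaks are joined in [h], and avoids [P] because [w], now the
   successor of [u], has degree above [mu]. *)
pose B := next s' @: breaks h s'; pose T := next s' @: [set v | h u v].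
have dis : T \subset ~: (P :|: B).
  apply/subsetP => z /imsetP[v]; rewrite inE => huv ->.
  have nBv : h v (next s' v).
    apply/negPn/negP => nhv.
    have neuv : u != v by apply: contraTneq huv => <-; rewrite hI.
    by have [/negP] := break_pair hS hI ms' neuv nhu' nhv.
  rewrite !inE mem_imset // inE nBv orbF; apply/negP => zP.
  have := break_neighbour hS hI ms' nBv nhu'; rewrite hS Nu => /(_ huv).
  by have := Pmu _ zP; move: dw; clear; lia.
(* Successors of two breaks have degree sum at most [cyc_count h s']. So [P] and [B] are almost
   disjoint and leave at most [mu] places for [T]. *)
have PB : #|P :&: B| <= 1.
  apply/card_le1_eqP => x y; rewrite !inE.
  case/andP=> xP /imsetP[a]; rewrite inE => nha Ex.
  case/andP=> yP /imsetP[b]; rewrite inE => nhb Ey.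
  apply/eqP/negPn/negP => nexy.
  have neab : a != b by apply: contraNneq nexy => Eab; rewrite Ex Ey Eab.
  have [_ _ + _] := break_pair hS hI ms' neab nha nhb; rewrite -Ex -Ey.
  have := P2 _ xP; have := P2 _ yP; clear; lia.
have := subset_leq_card dis; rewrite card_imset // -degE.
have := cardsC (P :|: B); have := cardsUI P B; have := card_breaks h s'.
rewrite card_imset // in PB *; move: PB cP du.
move: #|breaks h s'| #|P| #|V| #|P :|: B| #|P :&: B| #|~: _| (deg h u).
clear; lia.
Qed.

(** A pair in [h] that is not inside the set of large degrees has a first or a second entry of
    degree at most [mu]; each case accounts for at most [#|V| * mu] ordered pairs. *)
Lemma sum_deg_le (V : finType) (h : rel V) (m mu : nat) :
  symmetric h -> #|[set v | mu < deg h v]| <= m ->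
  \sum_v deg h v <= m * m + 2 * (#|V| * mu).
Proof.
move=> hS; set M := [set v | mu < deg h v] => cM.
have low : \sum_(v | v \notin M) deg h v <= #|V| * mu.
  rewrite -sum_nat_const big_mkcond /=; apply: leq_sum => v _.
  by case: ifP => //; rewrite inE -leqNgt.
rewrite (bigID (mem M)) /=.
have -> : \sum_(v in M) deg h v
    = \sum_(v in M) \sum_(w in M) h v w
      + \sum_(v in M) \sum_(w | w \notin M) h v w.
  by rewrite -big_split; apply: eq_bigr => v _; rewrite /deg (bigID (mem M)).
have h1 : \sum_(v in M) \sum_(w in M) h v w <= m * m.
  apply: leq_trans (_ : #|M| * #|M| <= _); last by rewrite leq_mul.
  rewrite -sum_nat_const; apply: leq_sum => v _.
  by rewrite -sum1_card; apply: leq_sum => w _; case: (h v w).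
have h2 : \sum_(v in M) \sum_(w | w \notin M) h v w
    <= \sum_(v | v \notin M) deg h v.
  rewrite exchange_big /=; apply: leq_sum => w _.
  rewrite /deg [X in _ <= X](bigID (mem M)) /=; apply: leq_trans (leq_addr _ _).
  by apply: leq_sum => v _; rewrite hS.
rewrite -addnA leq_add // mul2n -addnn leq_add //.
exact: leq_trans low.
Qed.

(** * Counting over all colours *)

Lemma monochromatic_ordering (V : finType) (r k mu : nat) (g : rel V)
    (h : 'I_r -> rel V) :
  (forall i, symmetric (h i)) -> (forall i, irreflexive (h i)) ->
  (forall x y, g x y -> exists i, h i x y) ->
  2 <= r -> 0 < #|V| -> r * k = #|V| + mu -> 12 * (r * mu) <= #|V| ->
  (forall v, #|V| + k <= 2 * deg g v) ->
  exists i s, ordering s /\ k <= cyc_count (h i) s.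
Proof.
move=> hS hI gh r2 n0 Erk mu_small dg.
have [s ms] : exists s, forall i, max_ordering (h i) (s i).
  exact: (fin_all_exists (fun i => ordering_max (h i))).
have [/existsP[i ki]|/existsPn none] :=
    boolP [exists i, k <= cyc_count (h i) (s i)].
  by exists i, (s i); split=> //; case: (ms i).
have fk i : cyc_count (h i) (s i) < k by rewrite ltnNge none.
have dgh v : deg g v <= \sum_i deg (h i) v.
  rewrite /deg exchange_big /=; apply: leq_sum => w _.
  case gvw: (g v w) => //; have [i hi] := gh _ _ gvw.
  by rewrite (bigD1 i) //= hi.
pose L i := [set v | cyc_count (h i) (s i) < 2 * deg (h i) v].
pose P i := [set v | [forall (j | j != i), v \notin L j]].
have cL i : #|L i| <= k by apply: leq_trans (fk i); apply: card_large_deg.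
have sum_other (i : 'I_r) F m :
    (forall j, j != i -> F j <= m) -> \sum_(j | j != i) F j <= r.-1 * m.
  move=> Fm; apply: leq_trans (leq_sum _ Fm) _.
  by rewrite sum_nat_const cardC1 card_ord.
have rk : r * k = k + r.-1 * k by rewrite -mulSn prednK // ltnW.
(* A vertex outside [P i] lies in some [L j] with [j != i]; together these sets have at most (r - 1)
   k = n + mu - k vertices. *)
have cP i : k <= #|P i| + mu.
  have : #|~: P i| <= r.-1 * k.
    apply: leq_trans (sum_other i (fun j => #|L j|) k (fun j _ => cL j)).
    rewrite -sum1_card big_mkcond /=.
    under [X in _ <= X]eq_bigr => j _ do rewrite -sum1_card big_mkcond.
    rewrite exchange_big /=; apply: leq_sum => v _.
    rewrite !inE; case: ifP => // /forallPn[j]; rewrite negb_imply negbK.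
    by case/andP=> ji vL; rewrite (bigD1 j) //= vL.
  by have := cardsC (P i); lia.
(* In every other colour twice the degree of [z] is at most k - 1, while twice the total is at least
   n + k. *)
have dP i z : z \in P i -> 2 * k <= 2 * deg (h i) z + mu.
  rewrite inE => /forall_inP Pz.
  have : \sum_(j | j != i) 2 * deg (h j) z <= r.-1 * k.-1.
    apply: sum_other => j /Pz; rewrite inE -leqNgt => /leq_trans; apply.
    by have := fk j; lia.
  rewrite -big_distrr /=.
  have := dg z; have := dgh z; rewrite (bigD1 i) //=.
  have := fk i.
  rewrite rk in Erk.
  have Ek : r.-1 * k = r.-1 * k.-1 + r.-1.
    by have := fk i; case: (k) => // k' _; rewrite mulnS addnC.
  rewrite Ek in Erk.
  move: Erk (deg g z) (deg (h i) z); move: #|V| (r.-1 * k.-1).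
  by move: (\sum_(j | j != i) _); clear; lia.
(* This yields mu <= k, so 2 k - mu exceeds every count below [k]. *)
have muk : 12 * mu <= k + mu.
  rewrite -(@leq_pmul2l r) ?(ltnW r2) // mulnDr Erk mulnCA; lia.
have sum_i i : \sum_v deg (h i) v <= k * k + 2 * (#|V| * mu).
  apply: sum_deg_le => //; apply: leq_trans (fk i).
  apply: (card_medium_deg (P := P i)) => //.
  - by move=> z /dP; have := fk i; lia.
  - by move=> z /dP; have := fk i; lia.
  - exact: leq_trans (fk i) (cP i).
have : #|V| * (#|V| + k) <= 2 * (r * (k * k + 2 * (#|V| * mu))).
  rewrite -[X in X * _]sum1_card big_distrl /=.
  apply: leq_trans (_ : \sum_v 2 * deg g v <= _).
    by apply: leq_sum => v _; rewrite mul1n.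
  rewrite -big_distrr leq_pmul2l //=.
  apply: leq_trans (leq_sum _ (fun v _ => dgh v)) _.
  rewrite exchange_big /=.
  apply: leq_trans (leq_sum _ (fun i _ => sum_i i)) _.
  by rewrite sum_nat_const card_ord.
move: #|V| n0 Erk mu_small => n n0 Erk mu_small le.
have mu24 : 24 * mu <= n.
  apply: leq_trans mu_small; rewrite -[24]/(12 * 2) -mulnA leq_mul2l /=.
  by rewrite leq_mul2r r2 orbT.
(* Multiplying by [r] and putting n + mu for r k leaves, up to small terms in [mu], r n^2 + n^2 on
   the left against 2 n^2 + r n^2 / 3 on the right, which is impossible for r >= 2. *)
have le2 : n * (r * n) + n * (n + mu)
    <= 2 * ((n + mu) * (n + mu)) + 4 * ((r * n) * (r * mu)).
  rewrite -Erk.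
  have -> : n * (r * n) + n * (r * k) = r * (n * (n + k)).
    by rewrite -mulnDr -mulnDr mulnCA.
  have -> : 2 * (r * k * (r * k)) + 4 * (r * n * (r * mu))
      = r * (2 * (r * (k * k + 2 * (n * mu)))).
    by ring.
  by rewrite leq_mul2l le orbT.
have le3 : 12 * ((r * n) * (r * mu)) <= (r * n) * n.
  by rewrite mulnCA leq_mul2l mu_small orbT.
have le4 : 2 * (n * n) <= (r * n) * n by rewrite -mulnA leq_mul2r r2 orbT.
have le5 : 24 * (n * mu) <= n * n by rewrite mulnCA leq_mul2l mu24 orbT.
have le6 : 24 * (mu * mu) <= n * mu by rewrite mulnA leq_mul2r mu24 orbT.
have n1 : 0 < n * n by rewrite muln_gt0 n0.
move: le2 le3 le4 le5 le6 n1; rewrite !mulnDr !mulnDl (mulnC n (r * n)) (mulnC mu n).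
move: (r * n * n) (r * n * (r * mu)) (n * n) (n * mu) (mu * mu); clear; lia.
Qed.

(** * Colour classes as relations on the vertices *)

Lemma edge_setE (V : finType) (G : sgraph V) (x y : V) :
  ([set x; y] \in edge_set G) = G x y.
Proof.
apply/imset2P/idP => [[a b _]|Gxy]; last by exists x y; rewrite ?inE.
rewrite inE => Gab Eab.
have : a \in [set x; y] by rewrite Eab set21.
have : b \in [set x; y] by rewrite Eab set22.
have : x \in [set a; b] by rewrite -Eab set21.
have : y \in [set a; b] by rewrite -Eab set22.
have nab : a != b by apply: contraTneq Gab => ->; rewrite adj_irr.
rewrite !inE => /orP[]/eqP-> /orP[]/eqP-> //; rewrite ?eqxx ?orbb.
- by move/eqP=> Eba; rewrite Eba eqxx in nab.
- by rewrite adj_sym.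
- by move=> _ /eqP Eba; rewrite Eba eqxx in nab.
Qed.

Definition colour_rel (V : finType) (G : sgraph V) (r : nat)
    (c : edge_colouring G r) (i : 'I_r) : rel V :=
  fun x y => [exists a : edge G, (val a == [set x; y]) && (c a == i)].

Lemma colour_relP (V : finType) (G : sgraph V) (r : nat)
    (c : edge_colouring G r) (i : 'I_r) (x y : V) :
  reflect (exists2 a : edge G, val a = [set x; y] & c a = i) (colour_rel c i x y).
Proof.
apply: (iffP existsP) => [[a /andP[/eqP Ea /eqP ca]]|[a Ea ca]]; exists a => //.
by rewrite Ea ca !eqxx.
Qed.

Lemma colour_rel_adj (V : finType) (G : sgraph V) (r : nat)
    (c : edge_colouring G r) (i : 'I_r) : subrel (colour_rel c i) G.
Proof. by move=> x y /colour_relP[a Ea _]; rewrite -edge_setE -Ea (valP a). Qed.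

Lemma colour_rel_sym (V : finType) (G : sgraph V) (r : nat)
    (c : edge_colouring G r) (i : 'I_r) : symmetric (colour_rel c i).
Proof. by move=> x y; rewrite /colour_rel setUC. Qed.

Lemma colour_rel_irr (V : finType) (G : sgraph V) (r : nat)
    (c : edge_colouring G r) (i : 'I_r) : irreflexive (colour_rel c i).
Proof.
by move=> x; exact: contraFF (@colour_rel_adj _ _ _ c i x x) (adj_irr G x).
Qed.

Lemma adj_colour_rel (V : finType) (G : sgraph V) (r : nat)
    (c : edge_colouring G r) (x y : V) : G x y -> exists i, colour_rel c i x y.
Proof.
rewrite -edge_setE => Exy.
pose a : edge G := exist (fun A => A \in edge_set G) _ Exy.
by exists (c a); apply/colour_relP; exists a.
Qed.

Lemma next_next_neq (V : finType) (s : seq V) (x : V) :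
  uniq s -> 2 < size s -> x \in s -> next s (next s x) != x.
Proof.
move=> Us s3 xs; have [i p Ep] := rot_to xs.
rewrite -(next_rot i Us) -(next_rot i Us) Ep.
have : uniq (x :: p) by rewrite -Ep rot_uniq.
have : 2 < size (x :: p) by rewrite -Ep size_rot.
case: p {Ep} => [|a [|b p]] //= _; rewrite !inE !negb_or => /andP[/and3P[xa xb _] _].
by rewrite eqxx (eq_sym a x) (negPf xa) eqxx eq_sym.
Qed.

(** Distinct vertices give distinct cycle edges: if {x, x'} = {y, y'} with x and y different, then
    x'' = x, which a length above 2 excludes. *)
Lemma cyc_count_coloured (V : finType) (G : sgraph V) (r : nat)
    (c : edge_colouring G r) (s : seq V) (i : 'I_r) :
  ordering s -> 2 < size s ->
  cyc_count (colour_rel c i) s <= #|coloured_cycle_edges c s i|.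
Proof.
case=> Us As s3.
pose A := [set x | colour_rel c i x (next s x)].
have -> : cyc_count (colour_rel c i) s = #|A|.
  by rewrite -sum1dep_card [RHS]big_mkcond; apply: eq_bigr => x _; case: ifP.
have inj : {in A &, injective (fun x => [set x; next s x])}.
  move=> x y _ _ Exy; apply/eqP/negPn/negP => nxy.
  have : x \in [set y; next s y] by rewrite -Exy set21.
  have : y \in [set x; next s x] by rewrite Exy set21.
  rewrite !inE (negPf nxy) eq_sym (negPf nxy) /= => /eqP Ey /eqP Ex.
  by have := next_next_neq Us s3 (As x); rewrite -Ey -Ex eqxx.
rewrite -(card_in_imset inj) -[X in _ <= X](card_imset _ val_inj).
apply: subset_leq_card.
apply/subsetP => _ /imsetP[x xA ->]; move: xA; rewrite inE => /colour_relP[a Ea ca].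
apply/imsetP; exists a => //; rewrite inE ca eqxx andbT Ea.
by apply/imsetP; exists x.
Qed.

Lemma min_degree_le (V : finType) (G : sgraph V) (v : V) :
  min_degree G <= deg G v.
Proof.
rewrite degE -/(degree G v) /min_degree.
have := mem_index_enum v; elim: (index_enum V) => // u t IHt.
rewrite inE big_cons geq_min => /predU1P[->|/IHt ->]; rewrite ?leqnn ?orbT //.
Qed.

(** * From real bounds to integers *)

Import Order.TTheory GRing.Theory Num.Theory.
Local Open Scope ring_scope.

Theorem theorem1p11 (r : nat) (hr : (2 <= r)%N) :
  exists n0 : nat,
    forall (n : nat) (R : realFieldType) (d : R),
      (n0 <= n)%N ->
      0 <= d <= n%:R / (28 * r%:R ^+ 2) ->
      forall (V : finType) (G : sgraph V),
        #|V| = n ->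
        (r%:R + 1) * n%:R / (2 * r%:R) + d <= (min_degree G)%:R ->
        forall c : edge_colouring G r,
          exists s : seq V,
            hamilton_cycle G s /\
            exists i : 'I_r,
              n%:R / r%:R + 2 * d <= #|coloured_cycle_edges c s i|%:R.
Proof.
(* Let k be the ceiling of n/r + 2d. Then r k - n < r + 2 r d <= r + n / (14 r), so 12 r (r k - n)
   <= 12 r^2 + 6 n / 7, which is at most n once n >= 84 r^2. *)
exists (84 * r ^ 2)%N => n R d n_large /andP[d0 dn] V G cV dG c.
have r2 : (2%:R : R) <= r%:R by rewrite ler_nat.
have rn0 : (r%:R : R) != 0 by rewrite pnatr_eq0 -lt0n ltnW.
have n_big : (336 <= n)%N.
  apply: leq_trans n_large; rewrite -[336%N]/(84 * 2 ^ 2)%N leq_mul2l.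
  by rewrite leq_exp2r.
pose q : R := n%:R / r%:R.
have qr : q * r%:R = n%:R by rewrite divfK.
have dr : d * (28 * r%:R ^+ 2) <= n%:R.
  by rewrite -ler_pdivlMr // mulr_gt0 // exprn_gt0 //; move: r2; clear; lra.
have Emin : (r%:R + 1) * n%:R / (2 * r%:R) = (n%:R + q) / 2 :> R.
  by rewrite /q; field.
have bound : n%:R + q + 2 * d <= (2 * min_degree G)%:R.
  by rewrite natrM; move: dG; rewrite Emin; clear; lra.
have q0 : 0 < q by rewrite divr_gt0 ?ltr0n; [|move: n_big; clear; lia|exact: ltnW].
have nR0 : 0 <= n%:R :> R by rewrite ler0n.
have ex_k : exists k : nat, q + 2 * d <= k%:R.
  by exists (2 * min_degree G)%N; move: bound nR0; clear; lra.
have [k qk kmin] := ex_minnP ex_k.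
(* The integer 2 delta - n is at least n/r + 2d, so minimality of [k] applies to it. *)
have nk : (n + k <= 2 * min_degree G)%N.
  have nle : (n <= 2 * min_degree G)%N.
    by rewrite -(ler_nat R); move: bound q0 d0; clear; lra.
  by rewrite -leq_subRL //; apply: kmin; rewrite natrB //; move: bound; clear; lra.
have k0 : (0 < k)%N by rewrite -(ltr_nat R); move: qk q0 d0; clear; lra.
have k1 : k.-1%:R < q + 2 * d.
  by rewrite ltNge; apply/negP => /kmin; rewrite leqNgt ltn_predL k0.
have nrk : (n <= r * k)%N.
  rewrite -(ler_nat R) natrM -qr mulrC ler_wpM2l ?ler0n //.
  by move: qk d0; clear; lra.
(* The bound r (k - 1) <= n + n / (14 r), cleared of denominators. *)
have rk : (14 * r * (r * k.-1) <= 14 * r * n + n)%N.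
  rewrite -(ler_nat R) natrD !natrM.
  have r14 : 0 <= 14 * r%:R * r%:R :> R by rewrite !mulr_ge0 // ler0n.
  have := ler_wpM2l r14 (ltW k1).
  have -> : 14 * r%:R * r%:R * (q + 2 * d)
      = 14 * r%:R * (q * r%:R) + d * (28 * r%:R ^+ 2) by ring.
  by rewrite qr -[X in X <= _]mulrA => /le_trans; apply; rewrite lerD2l.
have mu_small : (12 * (r * (r * k - n)) <= #|V|)%N.
  have -> : (r * (r * k - n) = r * r + r * (r * k.-1) - r * n)%N.
    by rewrite mulnBr -mulnDr -mulnS prednK.
  rewrite cV; move: rk n_large; rewrite -!mulnA mulnn.
  by move: (r * (r * k.-1))%N (r * n)%N (r ^ 2)%N; clear; lia.
have [i [s [Os ks]]] :
    exists i s, ordering s /\ (k <= cyc_count (colour_rel c i) s)%N.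
  apply: (@monochromatic_ordering V r k (r * k - n) G) => //.
  - exact: colour_rel_sym.
  - exact: colour_rel_irr.
  - exact: adj_colour_rel.
  - by rewrite cV; move: n_big; clear; lia.
  - by rewrite cV subnKC.
  - move=> v; rewrite cV; apply: leq_trans nk _.
    by rewrite leq_mul2l min_degree_le.
(* The ordering [s] may step between non-adjacent vertices; the exchange repairs this and keeps at
   least [k] edges of colour [i]. *)
have [|s' [Os' ks' Gs']] := @posa_exchange V G (colour_rel c i) k s
  (@adj_sym _ G) (@adj_irr _ G) (@colour_rel_sym _ _ _ c i)
  (@colour_rel_adj _ _ _ c i) _ Os ks.
  move=> v; rewrite cV; apply: leq_trans nk _.
  by rewrite leq_mul2l min_degree_le.
have [Us As] := Os'.
have s3 : (2 < size s')%N.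
  have -> : size s' = #|V|.
    by rewrite cardE; apply/perm_size/uniq_perm => [||v];
      rewrite ?enum_uniq ?mem_enum ?As.
  by rewrite cV; move: n_big; clear; lia.
exists s'; split.
  by split=> //; apply: cycle_from_next => // x _.
exists i; apply: le_trans qk _.
by rewrite ler_nat (leq_trans ks') // cyc_count_coloured.
Qed.
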